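(* Let $P$ be a set of $n$ points in general position in the plane. Then there are three points $p_1,p_2,p_3\in\mathbb{R}^2$ such that (1) every closed halfplane containing at least one of $p_1,p_2,p_3$ contains at least $\frac{n}{6}$ points of $P$, and (2) every closed halfplane containing all of $p_1,p_2,p_3$ contains at least $\frac{n}{2}$ points of $P$.
   Context: General position means no three points of $P$ are collinear. *)

(* Defs.v *)
From HB Require Import structures.
From mathcomp Require Import all_boot all_order all_algebra.
From mathcomp Require Import reals.
Set Implicit Arguments. Unset Strict Implicit. Unset Printing Implicit Defensive.
Import Order.TTheory GRing.Theory Num.Theory.
Local Open Scope ring_scope.

Section Plane.
Variable R : realType.

Definition point := (R * R)%type.

Definition orient (p q r : point) : R :=
  (q.1 - p.1) * (r.2 - p.2) - (q.2 - p.2) * (r.1 - p.1).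

Definition collinear (p q r : point) : Prop := orient p q r = 0.

(* P (a duplicate-free list of points) is in general position:
   no three distinct points of P are collinear. *)
Definition general_position (P : seq point) : Prop :=
  forall p q r, p \in P -> q \in P -> r \in P ->
    p != q -> q != r -> p != r -> ~ collinear p q r.

Definition in_halfplane (a b c : R) (x : point) : bool :=
  a * x.1 + b * x.2 <= c.

Definition is_halfplane (a b c : R) : Prop := (a, b) <> (0, 0).

Definition count_in (a b c : R) (P : seq point) : nat :=
  count (in_halfplane a b c) P.

End Plane.

(* Main.v *)
From mathcomp Require Import boolp classical_sets topology normedtype derive.
From mathcomp Require Import ring lra zify.
Require Import Defs.
From HB Require Import structures.
From mathcomp Require Import all_boot all_order all_algebra.
From mathcomp Require Import reals.
Set Implicit Arguments. Unset Strict Implicit. Unset Printing Implicit Defensive.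
Import Order.TTheory GRing.Theory Num.Theory.
Local Open Scope ring_scope.

(** Let [k] and [m] be the ceilings of [n / 6] and [n / 2], and let [D] be the
    set of points of Tukey depth at least [k].  Call a subset [Q] of [P] heavy
    if more than [n - m] of the points lie in it.  Among three heavy sets two
    share at least [k] points, and then Helly's theorem makes their hulls meet
    inside [D].  Take for [p1] a vertex of [D] and view [D] from [p1]: the
    traces on [D] of the hulls of the heavy sets avoiding [p1] become intervals
    of directions, no three of which are pairwise disjoint, for if one
    direction meets two traces, the farthest point of [D] in that direction
    lies beyond both.  Hence two directions pierce all the intervals, and [p2],
    [p3] are the farthest points of [D] in these directions.  A halfplane
    containing [p1], [p2], [p3] and fewer than [m] points of [P] would have a
    heavy complement, whose hull meets a segment [p1 p2] or [p1 p3]. *)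

(** * Helly's theorem in the plane *)

Section Convexity.
Variable R : realType.
Implicit Types (x y z : point R) (C : point R -> Prop).

Definition convex_pred C := forall x y (s t : R),
  0 <= s -> 0 <= t -> s + t = 1 -> C x -> C y ->
  C (s * x.1 + t * y.1, s * x.2 + t * y.2).

(** The weights keep their total [w] instead of 1, the form in which a Radon point appears in
    [helly4]. *)
Lemma convex_pred3 C x y z (r s t w : R) :
    convex_pred C -> C x -> C y -> C z ->
    0 <= r -> 0 <= s -> 0 <= t -> r + s + t = w -> 0 < w ->
  C ((r * x.1 + s * y.1 + t * z.1) / w, (r * x.2 + s * y.2 + t * z.2) / w).
Proof.
move=> cC Cx Cy Cz r0 s0 t0 rst w0; have wN0 := lt0r_neq0 w0.
have [rs0|rs0] := eqVneq (r + s) 0.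
  have [-> ->] : r = 0 /\ s = 0 by split; lra.
  have -> : t = w by lra.
  by rewrite !mul0r !add0r ![w * _]mulrC !mulfK // -surjective_pairing.
have rs_gt0 : 0 < r + s by rewrite lt_def rs0 addr_ge0.
set u := (r / (r + s) * x.1 + s / (r + s) * y.1,
          r / (r + s) * x.2 + s / (r + s) * y.2).
have Cu : C u.
  by apply: cC => //; rewrite ?divr_ge0 ?(ltW rs_gt0) // -mulrDl divff.
have -> : ((r * x.1 + s * y.1 + t * z.1) / w, (r * x.2 + s * y.2 + t * z.2) / w)
   = ((r + s) / w * u.1 + t / w * z.1, (r + s) / w * u.2 + t / w * z.2).
  by rewrite /u /=; congr (_, _); field; rewrite wN0 rs0.
by apply: cC => //; rewrite ?divr_ge0 ?(ltW rs_gt0) ?(ltW w0) //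
  -mulrDl rst divff.
Qed.

(** The rows [(1, x, y)] of four points form a 4 by 3 matrix, so its left kernel is nonzero. *)
Lemma affine_dependence4 (x1 x2 x3 x4 : point R) :
  exists v1 v2 v3 v4 : R,
   [/\ v1 + v2 + v3 + v4 = 0,
       v1 * x1.1 + v2 * x2.1 + v3 * x3.1 + v4 * x4.1 = 0,
       v1 * x1.2 + v2 * x2.2 + v3 * x3.2 + v4 * x4.2 = 0
     & ~ [/\ v1 = 0, v2 = 0, v3 = 0 & v4 = 0]].
Proof.
pose X (i : 'I_4) := nth x1 [:: x1; x2; x3; x4] i.
pose M : 'M[R]_(4, 3) := \matrix_(i, j) nth 0 [:: 1; (X i).1; (X i).2] j.
have : kermx M != 0.
  rewrite -mxrank_eq0 mxrank_ker -lt0n subn_gt0.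
  exact: leq_ltn_trans (rank_leq_col M) _.
case/rowV0Pn => v /sub_kermxP vM v0.
have E j : \sum_i v 0 i * M i j = 0.
  by move/rowP: vM => /(_ j); rewrite !mxE.
have := (E (inord 0), E (inord 1), E (inord 2)).
rewrite !big_ord_recl !big_ord0 !mxE !inordK //= !addr0 !addrA !mulr1.
move=> [[E0 E1] E2].
exists (v 0 ord0), (v 0 (lift ord0 ord0)), (v 0 (lift ord0 (lift ord0 ord0))),
  (v 0 (lift ord0 (lift ord0 (lift ord0 ord0)))); split => //.
case=> z1 z2 z3 z4; case/eqP: v0; apply/rowP => i; rewrite [RHS]mxE.
case: i => -[|[|[|[|//]]]] lti.
- by rewrite -[RHS]z1; congr (v _ _); apply: val_inj.
- by rewrite -[RHS]z2; congr (v _ _); apply: val_inj.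
- by rewrite -[RHS]z3; congr (v _ _); apply: val_inj.
- by rewrite -[RHS]z4; congr (v _ _); apply: val_inj.
Qed.

Lemma pos_neg_parts (v : R) : exists p m : R,
  [/\ v = p - m, 0 <= p, 0 <= m & p = 0 \/ m = 0].
Proof.
have [v0|v0] := leP 0 v.
  by exists v, 0; split => //; [rewrite subr0|right].
by exists 0, (- v); split => //; [rewrite opprK add0r|lra|left].
Qed.

(* The Radon point of [x1], [x2], [x3], [x4] lies in all four sets. *)
Lemma helly4 C1 C2 C3 C4 :
    convex_pred C1 -> convex_pred C2 -> convex_pred C3 -> convex_pred C4 ->
    (exists x, [/\ C2 x, C3 x & C4 x]) -> (exists x, [/\ C1 x, C3 x & C4 x]) ->
    (exists x, [/\ C1 x, C2 x & C4 x]) -> (exists x, [/\ C1 x, C2 x & C3 x]) ->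
  exists x, [/\ C1 x, C2 x, C3 x & C4 x].
Proof.
move=> c1 c2 c3 c4 [x1 [h12 h13 h14]] [x2 [h21 h23 h24]].
move=> [x3 [h31 h32 h34]] [x4 [h41 h42 h43]].
have [v1 [v2 [v3 [v4 [e0 e1 e2 vN0]]]]] := affine_dependence4 x1 x2 x3 x4.
have [a1 [b1 [E1 a1p b1p o1]]] := pos_neg_parts v1.
have [a2 [b2 [E2 a2p b2p o2]]] := pos_neg_parts v2.
have [a3 [b3 [E3 a3p b3p o3]]] := pos_neg_parts v3.
have [a4 [b4 [E4 a4p b4p o4]]] := pos_neg_parts v4.
have w0 : 0 < a1 + a2 + a3 + a4.
  rewrite lt_def !addr_ge0 // andbT; apply/negP => /eqP s0.
  by apply: vN0; split; lra.
rewrite {}E1 {}E2 {}E3 {}E4 {vN0} in e0 e1 e2.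
move: w0; have [w wA] : exists w, a1 + a2 + a3 + a4 = w by eexists.
rewrite wA => w0.
have wB : b1 + b2 + b3 + b4 = w by lra.
pose q : point R := ((a1 * x1.1 + a2 * x2.1 + a3 * x3.1 + a4 * x4.1) / w,
                     (a1 * x1.2 + a2 * x2.2 + a3 * x3.2 + a4 * x4.2) / w).
have qE : q = ((b1 * x1.1 + b2 * x2.1 + b3 * x3.1 + b4 * x4.1) / w,
               (b1 * x1.2 + b2 * x2.2 + b3 * x3.2 + b4 * x4.2) / w).
  by rewrite /q; congr (_ / _, _ / _); lra.
exists q; split.
(* As [a1] or [b1] vanishes, one of the two expressions of [q] involves only the other three points,
   which all lie in [C1]. The other cases are alike. *)
- case: o1 => z; [rewrite /q|rewrite qE]; rewrite z !mul0r !add0r;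
    apply: convex_pred3 => //; lra.
- case: o2 => z; [rewrite /q|rewrite qE]; rewrite z !mul0r !addr0;
    apply: convex_pred3 => //; lra.
- case: o3 => z; [rewrite /q|rewrite qE]; rewrite z !mul0r !addr0;
    apply: convex_pred3 => //; lra.
- case: o4 => z; [rewrite /q|rewrite qE]; rewrite z !mul0r !addr0;
    apply: convex_pred3 => //; lra.
Qed.

Lemma helly (T : eqType) (C : T -> point R -> Prop) (s : seq T) :
    (forall a, convex_pred (C a)) ->
    (forall a b c, a \in s -> b \in s -> c \in s ->
       exists x, [/\ C a x, C b x & C c x]) ->
  exists x, forall a, a \in s -> C a x.
Proof.
move=> cC triple.
(* The induction carries a convex set [E], the intersection of the sets already treated. Passing to
   [E] and [C a], [helly4] restores the condition on pairs. *)
pose E (_ : point R) := True.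
suff [x [_ Cx]] : exists x, E x /\ forall a, a \in s -> C a x by exists x.
have cE : convex_pred E by [].
have Epair a b : a \in s -> b \in s -> exists x, [/\ E x, C a x & C b x].
  by move=> sa sb; have [x []] := triple _ _ _ sa sa sb; exists x.
have : exists x, E x by exists (0, 0).
move: E cE Epair triple; elim: s => [|a s IH] E cE Epair triple [e Ee].
  by exists e.
have sub b : b \in s -> b \in a :: s by rewrite in_cons orbC => ->.
have as_a := mem_head a s.
have [||||x [[Ex Cax] Cx]] := IH (fun x => E x /\ C a x).
- move=> x y r t r0 t0 rt [Ex Cx] [Ey Cy].
  by split; [apply: cE|apply: cC].
- move=> b c /sub sb /sub sc.
  have [] := @helly4 E (C a) (C b) (C c) => //; try exact: Epair.
    exact: triple.
  by move=> x [Ex ? ? ?]; exists x.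
- by move=> b c d /sub sb /sub sc /sub sd; apply: triple.
- by have [x []] := Epair _ _ as_a as_a; exists x.
exists x; split=> // b; rewrite in_cons => /orP[/eqP->//|]; exact: Cx.
Qed.

End Convexity.

(** * Pigeonhole bounds and piercing of intervals *)

Section Counting.
Local Open Scope nat_scope.
Variable T : finType.
Implicit Types A B C : {set T}.

Lemma card_meet2 A B : #|T| < #|A| + #|B| -> exists2 i, i \in A & i \in B.
Proof.
move=> h; have : 0 < #|A :&: B|.
  by have := cardsUI A B; have := max_card (A :|: B); lia.
by case/card_gt0P => i; rewrite inE => /andP[iA iB]; exists i.
Qed.

Lemma card_meet3 A B C :
  #|T|.*2 < #|A| + #|B| + #|C| -> exists i, [/\ i \in A, i \in B & i \in C].
Proof.
move=> h; have [|i] := @card_meet2 (A :&: B) C; last first.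
  by rewrite inE => /andP[iA iB] iC; exists i.
by have := cardsUI A B; have := max_card (A :|: B); lia.
Qed.

(** Inclusion-exclusion with the triple intersection dropped. *)
Lemma card_pair_meet A B C :
  #|A| + #|B| + #|C| <= #|T| + (#|A :&: B| + #|A :&: C| + #|B :&: C|).
Proof.
have := cardsUI (A :|: B) C; have := cardsUI A B.
have := max_card (A :|: B :|: C).
have : #|(A :|: B) :&: C| <= #|A :&: C| + #|B :&: C|.
  by rewrite setIUl cardsU leq_subr.
by lia.
Qed.

End Counting.

(** Greedy choice: [i] has the least right end, and [j] the least right end among the intervals
    starting after [r i]. An interval missing both ends would be the third of three disjoint
    ones. *)
Lemma interval_pierce (R : realType) (T : finType) (F : pred T) (l r : T -> R) :
    (exists i, F i) -> (forall i, F i -> l i <= r i) ->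
    (forall i j k, F i -> F j -> F k ->
       r i < l j -> r i < l k -> r j < l k -> False) ->
  exists i j, [/\ F i, F j & forall k, F k ->
    (l k <= r i <= r k) || (l k <= r j <= r k)].
Proof.
move=> [i0 Fi0] lr no3.
have [i Fi imin] := arg_minP r Fi0.
have [/existsP[j0 Gj0]|G0] := boolP [exists j, F j && (r i < l j)].
  have [j /andP[Fj ij] jmin] :=
    @arg_minP _ _ _ j0 [pred j | F j && (r i < l j)] r Gj0.
  exists i, j; split => // k Fk; rewrite imin // andbT.
  have [//|ik] := leP (l k) (r i).
  have -> : r j <= r k by apply: jmin; rewrite /= Fk.
  by rewrite andbT leNgt; apply/negP => jk; apply: (no3 i j k).
exists i, i; split => // k Fk; rewrite imin // andbT orbb leNgt.
by apply: contra G0 => ik; apply/existsP; exists k; rewrite Fk.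
Qed.

(** * Hulls and Tukey depth of a finite family *)

Section Hull.
Variables (R : realType) (n : nat) (X : 'I_n -> point R).
Implicit Types (A B Q : {set 'I_n}) (x : point R).

(** The hull is an intersection of halfplanes, which makes convexity and closedness immediate. *)
Definition hull Q x := forall a b c : R,
  (forall i, i \in Q -> in_halfplane a b c (X i)) -> in_halfplane a b c x.

(* [core k] is the set of points of Tukey depth at least [k]. *)
Definition core (k : nat) x := forall Q, (n < k + #|Q|)%N -> hull Q x.

Lemma convex_halfplane (a b c : R) : convex_pred (in_halfplane a b c).
Proof.
rewrite /in_halfplane => x y s t s0 t0 st /= hx hy.
have -> : c = s * c + t * c by rewrite -mulrDl st mul1r.
have := ler_wpM2l s0 hx; have := ler_wpM2l t0 hy; lra.
Qed.

Lemma convex_hull Q : convex_pred (hull Q).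
Proof.
move=> x y s t s0 t0 st hx hy a b c h.
by apply: convex_halfplane => //; [apply: hx|apply: hy].
Qed.

Lemma convex_core k : convex_pred (core k).
Proof.
move=> x y s t s0 t0 st hx hy Q h.
by apply: convex_hull => //; [apply: hx|apply: hy].
Qed.

Lemma sub_hull Q i : i \in Q -> hull Q (X i).
Proof. by move=> iQ a b c; apply. Qed.

Lemma hull_compl_halfplane (a b c : R) Q x :
  (forall i, i \in Q -> ~~ in_halfplane a b c (X i)) -> hull Q x ->
  ~~ in_halfplane a b c x.
Proof.
rewrite /in_halfplane => hQ hx; rewrite -ltNge.
have [Q0|[i0 i0Q]] := set_0Vmem Q.
  (* The triple [0, 0, -1] describes the empty set, so the hull of no points is empty. *)
  have : in_halfplane 0 0 (-1) x by apply: hx => i; rewrite Q0 inE.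
  by rewrite /in_halfplane; lra.
have [i iQ imin] := arg_minP (fun i => a * (X i).1 + b * (X i).2) i0Q.
have : in_halfplane (- a) (- b) (- (a * (X i).1 + b * (X i).2)) x.
  by apply: hx => j /imin; rewrite /in_halfplane; lra.
by move: (hQ i iQ); rewrite -ltNge /in_halfplane; lra.
Qed.

Lemma hull_helly (F : pred {set 'I_n}) :
    (forall A B C, F A -> F B -> F C ->
       exists i, [/\ i \in A, i \in B & i \in C]) ->
  exists x, forall Q, F Q -> hull Q x.
Proof.
move=> meetF; have [|A B C|x hx] := @helly R _ hull (enum F).
- exact: convex_hull.
- rewrite !mem_enum => FA FB FC; have [i [iA iB iC]] := meetF A B C FA FB FC.
  by exists (X i); split; apply: sub_hull.
- by exists x => Q FQ; apply: hx; rewrite mem_enum.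
Qed.

(** Helly is applied to the sets missing fewer than [k] indices and the sets of at least [2 * k - 1]
    indices containing [A :&: B]. If at least two of three members are of the first kind, counting
    gives a common index; otherwise one is found in [A :&: B], which has at least [k] elements. *)
Lemma core_meet_hull2 k A B :
    (3 * k < n + 3)%N -> (2 * k < #|A| + 2)%N -> (2 * k < #|B| + 2)%N ->
    (0 < k <= #|A :&: B|)%N ->
  exists x, [/\ core k x, hull A x & hull B x].
Proof.
move=> k3 kA kB /andP[k0 kAB].
pose F Q := (n < k + #|Q|)%N || (A :&: B \subset Q) && (2 * k < #|Q| + 2)%N.
have [|x hx] := @hull_helly F; last first.
  exists x; split=> [Q hQ||]; apply: hx; rewrite /F ?hQ //.
    by rewrite subsetIl kA orbT.
  by rewrite subsetIr kB orbT.
have meet2 (S : {set 'I_n}) : (n < k + #|S|)%N ->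
    exists2 i, i \in A :&: B & i \in S.
  by move=> hS; apply: card_meet2; rewrite card_ord; lia.
move=> S1 S2 S3.
case/orP=> [b1|/andP[/subsetP s1 c1]]; case/orP=> [b2|/andP[/subsetP s2 c2]];
  case/orP=> [b3|/andP[/subsetP s3 c3]];
  try by apply: card_meet3; rewrite card_ord; lia.
- by have [i iAB i1] := meet2 _ b1; exists i; split; auto.
- by have [i iAB i1] := meet2 _ b2; exists i; split; auto.
- by have [i iAB i1] := meet2 _ b3; exists i; split; auto.
- have /card_gt0P[i iAB] : (0 < #|A :&: B|)%N by lia.
  by exists i; split; auto.
Qed.

End Hull.

(** * Compactness of the core *)

Section Topology.
Local Open Scope classical_set_scope.
Import topology_structure numFieldNormedType.Exports.
Variable R : realType.

Lemma continuous_linear2 (a b : R) :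
  continuous (fun x : R * R => a * x.1 + b * x.2).
Proof.
move=> x; apply: cvgD; apply: cvgM; first exact: cvg_cst.
- exact: cvg_fst.
- exact: cvg_cst.
- exact: cvg_snd.
Qed.

Lemma closed_halfplane (a b c : R) :
  closed [set x : R * R | in_halfplane a b c x].
Proof.
apply: (@preimage_closed _ _ (fun x : R * R => a * x.1 + b * x.2)
  [set t | t <= c]).
- by move=> x _; apply: continuous_linear2.
- exact: closed_le.
Qed.

Lemma closed_hull n (X : 'I_n -> point R) Q :
  closed [set x : R * R | hull X Q x].
Proof.
pose I := [set h : R * R * R | forall i, i \in Q ->
  in_halfplane h.1.1 h.1.2 h.2 (X i)].
rewrite (_ : mkset _ = \bigcap_(h in I)
  [set x : R * R | in_halfplane h.1.1 h.1.2 h.2 x]).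
  by apply: closed_bigI => h _; apply: closed_halfplane.
apply/seteqP; split=> x /= hx; first by move=> h Ih; apply: hx.
by move=> a b c habc; apply: (hx (a, b, c)).
Qed.

Lemma compact_core n (X : 'I_n -> point R) k : (0 < k)%N ->
  compact [set x : R * R | core X k x].
Proof.
move=> k0.
pose M := \sum_i (`|(X i).1| + `|(X i).2|).
have leM i : `|(X i).1| + `|(X i).2| <= M.
  by rewrite /M (bigD1 i) //= lerDl sumr_ge0 // => j _; rewrite addr_ge0.
apply: (@subclosed_compact _ _ (`[- M, M] `*` `[- M, M])).
- rewrite (_ : mkset _ = \bigcap_(Q in [set Q : {set 'I_n} | (n < k + #|Q|)%N])
    [set x : R * R | hull X Q x]).
    by apply: closed_bigI => Q _; apply: closed_hull.
  by apply/seteqP; split=> x /= hx.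
- by apply: compact_setX; apply: segment_compact.
(* Since [k] is positive, the core lies in the hull of all the points, hence in the box of
   half-width [M]. *)
- move=> x /= /(_ [set: 'I_n]%SET).
  rewrite cardsT card_ord -{1}[n]add0n ltn_add2r => /(_ k0) hx.
  have {}leM i :
      [/\ (X i).1 <= M, - M <= (X i).1, (X i).2 <= M & - M <= (X i).2].
    have := leM i; have := ler_norm (X i).1; have := ler_norm (X i).2.
    have := ler_norm (- (X i).1); have := ler_norm (- (X i).2).
    rewrite !normrN => ? ? ? ? ?.
    have := normr_ge0 (X i).1; have := normr_ge0 (X i).2.
    by move=> ? ?; split; lra.
  have h1 : in_halfplane 1 0 M x.
    by apply: hx => i _; rewrite /in_halfplane; have [] := leM i; lra.
  have h2 : in_halfplane (-1) 0 M x.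
    by apply: hx => i _; rewrite /in_halfplane; have [] := leM i; lra.
  have h3 : in_halfplane 0 1 M x.
    by apply: hx => i _; rewrite /in_halfplane; have [] := leM i; lra.
  have h4 : in_halfplane 0 (-1) M x.
    by apply: hx => i _; rewrite /in_halfplane; have [] := leM i; lra.
  move: h1 h2 h3 h4; rewrite /in_halfplane !in_itv /=.
  by move=> *; split; apply/andP; split; lra.
Qed.

End Topology.

(* Polar coordinates about [p], relative to a direction [(u, v)]: on the open
   halfplane [height > 0], [slope] is the tangent of the angle to [(u, v)]. *)
Section Slope.
Variables (R : realType) (p : point R) (u v : R).
Implicit Types (x y z : point R) (C : point R -> Prop).

Definition height x : R := u * (x.1 - p.1) + v * (x.2 - p.2).
Definition offset x : R := u * (x.2 - p.2) - v * (x.1 - p.1).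
Definition slope x : R := offset x / height x.

Lemma slopeP x (t : R) : 0 < height x ->
  slope x = t <-> offset x = t * height x.
Proof.
move=> /lt0r_neq0 d0; rewrite /slope; split=> [<-|->]; last by rewrite mulfK.
by rewrite divfK.
Qed.

Lemma slope_between C x y (t : R) :
    convex_pred C -> (forall z, C z -> 0 < height z) -> C x -> C y ->
    slope x <= t <= slope y -> exists2 z, C z & slope z = t.
Proof.
move=> cC dC Cx Cy /andP[].
rewrite ler_pdivrMr ?dC // ler_pdivlMr ?dC // => xt ty.
(* [a] and [b] measure how far [x] and [y] are from the line of slope [t], on opposite sides;
   exchanged as weights, they give the crossing point of the segment. *)
pose a := t * height x - offset x; pose b := offset y - t * height y.
have a0 : 0 <= a by rewrite subr_ge0.
have b0 : 0 <= b by rewrite subr_ge0.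
have [ab0|ab0] := eqVneq (a + b) 0.
  by exists x => //; apply/slopeP; [exact: dC|rewrite /a /b in a0 b0 ab0; lra].
have ab_gt0 : 0 < a + b by rewrite lt_def ab0 addr_ge0.
pose z : point R := (b / (a + b) * x.1 + a / (a + b) * y.1,
                     b / (a + b) * x.2 + a / (a + b) * y.2).
have Cz : C z.
  apply: cC => //; rewrite ?divr_ge0 ?(ltW ab_gt0) // -mulrDl addrC divff //.
exists z => //; apply/slopeP; first exact: dC.
have dz : height z = (b * height x + a * height y) / (a + b).
  by rewrite /height /z /=; field.
have oz : offset z = (b * offset x + a * offset y) / (a + b).
  by rewrite /offset /z /=; field.
rewrite dz oz mulrA; congr (_ / _); rewrite /a /b; ring.
Qed.

Lemma convex_ray C x y (t : R) :
    convex_pred C -> C p -> C y -> 0 < height x <= height y ->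
    slope x = t -> slope y = t -> C x.
Proof.
move=> cC Cp Cy /andP[dx dxy]; have dy := lt_le_trans dx dxy.
move=> /(slopeP _ dx) ox /(slopeP _ dy) oy.
pose s := height x / height y.
have s0 : 0 <= s by rewrite divr_ge0 // ltW.
have s1 : s <= 1 by rewrite ler_pdivrMr // mul1r.
have dsE : height x = s * height y by rewrite divfK // gt_eqF.
have osE : offset x = s * offset y by rewrite ox oy dsE; ring.
have w0 : 0 < u ^+ 2 + v ^+ 2.
  rewrite lt_def addr_ge0 ?sqr_ge0 // andbT paddr_eq0 ?sqr_ge0 //.
  rewrite !sqrf_eq0; apply: contraL dx => /andP[/eqP u0 /eqP v0].
  by rewrite /height u0 v0 !mul0r addr0 ltxx.
(* On a common ray from [p], the ratio of heights places [x] on the segment from [p] to [y].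
   Coordinates are recovered from [height] and [offset] up to the factor [u ^+ 2 + v ^+ 2]. *)
have -> : x = ((1 - s) * p.1 + s * y.1, (1 - s) * p.2 + s * y.2).
  rewrite [LHS]surjective_pairing; congr (_, _); apply: (mulfI (lt0r_neq0 w0)).
    suff : u * (height x - s * height y) - v * (offset x - s * offset y) = 0.
      by rewrite /height /offset; lra.
    by rewrite dsE osE; ring.
  suff : v * (height x - s * height y) + u * (offset x - s * offset y) = 0.
    by rewrite /height /offset; lra.
  by rewrite dsE osE; ring.
by apply: cC => //; lra.
Qed.

End Slope.

(** * Extreme directions and farthest points of compact sets *)

Section CompactSlope.
Local Open Scope classical_set_scope.
Import topology_structure numFieldNormedType.Exports.
Variable R : realType.
Implicit Types C : set (R * R).

(* The point of [C] farthest from the origin is exposed. *)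
Lemma exists_exposed C : C !=set0 -> compact C ->
  exists p u v, C p /\ forall x, C x -> x <> p -> 0 < height p u v x.
Proof.
move=> C0 cC.
have [|p] :=
    compact_EVT_max (f := fun x : R * R => x.1 * x.1 + x.2 * x.2) C0 cC.
  apply: continuous_subspaceT => x; apply: cvgD; apply: cvgM;
    by [exact: cvg_fst|exact: cvg_snd].
(* In this direction twice the height of [x] is [|x - p|^2 + |p|^2 - |x|^2]. *)
move=> /set_mem Cp pmax; exists p, (- p.1), (- p.2); split=> // x Cx xp.
have := pmax x (mem_set Cx); rewrite /height => le_xp.
have : 0 < (x.1 - p.1) ^+ 2 + (x.2 - p.2) ^+ 2.
  rewrite lt_def addr_ge0 ?sqr_ge0 // andbT paddr_eq0 ?sqr_ge0 //.
  rewrite !sqrf_eq0 !subr_eq0; apply/negP => /andP[/eqP e1 /eqP e2].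
  by apply: xp; rewrite [x]surjective_pairing e1 e2 -surjective_pairing.
by lra.
Qed.

Lemma continuous_height (p : R * R) (u v : R) : continuous (height p u v).
Proof.
have -> : height p u v =
    fun x => u * x.1 + v * x.2 - (u * p.1 + v * p.2).
  by apply/funext => x; rewrite /height; ring.
move=> x; apply: cvgB; last exact: cvg_cst.
exact: continuous_linear2.
Qed.

(** [offset] is the height along the direction turned by a right angle, so it inherits
    continuity. *)
Lemma offsetE (p : R * R) (u v : R) : offset p u v = height p (- v) u.
Proof. by apply/funext => x; rewrite /height /offset; ring. Qed.

Lemma slope_extrema C p (u v : R) :
    C !=set0 -> compact C -> (forall x, C x -> 0 < height p u v x) ->
  exists x y, [/\ C x, C y & forall z, C z ->
    slope p u v x <= slope p u v z <= slope p u v y].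
Proof.
move=> C0 cC dC.
have cs : {within C, continuous (slope p u v)}.
  apply: continuous_in_subspaceT => x /set_mem /dC /lt0r_neq0 dx.
  apply: cvgM; last by apply: cvgV => //; apply: continuous_height.
  by rewrite offsetE; apply: continuous_height.
have [x] := compact_EVT_min C0 cC cs => /set_mem Cx xmin.
have [y] := compact_EVT_max C0 cC cs => /set_mem Cy ymax.
exists x, y; split=> // z Cz; by rewrite xmin ?ymax ?mem_set.
Qed.

Lemma exists_far_point C p (u v t : R) x : compact C -> C x ->
    0 < height p u v x -> slope p u v x = t ->
  exists q, [/\ C q, 0 < height p u v q, slope p u v q = t &
    forall z, C z -> 0 < height p u v z -> slope p u v z = t ->
      height p u v z <= height p u v q].
Proof.
move=> cC Cx dx sx.
(* The whole line through the ray is used because it is closed; the maximum of the height over it is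
   positive, as [x] competes. *)
pose L : set (R * R) := [set z | offset p u v z - t * height p u v z = 0].
have [|||q] := compact_EVT_max (f := height p u v) (A := C `&` L).
- by exists x; split=> //; rewrite /L /= ((slopeP _ dx).1 sx) subrr.
- apply: compact_closedI => //.
  apply: (@preimage_closed _ _
    (fun z => offset p u v z - t * height p u v z) [set 0]).
    move=> z _; apply: cvgB; first by rewrite offsetE; apply: continuous_height.
    by apply: cvgM; [exact: cvg_cst|apply: continuous_height].
  exact: closed_eq.
- by apply: continuous_subspaceT; apply: continuous_height.
move=> /set_mem[Cq Lq] qmax.
have {}qmax z : C z -> 0 < height p u v z -> slope p u v z = t ->
    height p u v z <= height p u v q.
  move=> Cz dz sz; apply/qmax/mem_set; split=> //.
  by rewrite /L /= ((slopeP _ dz).1 sz) subrr.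
have dq : 0 < height p u v q by apply: (lt_le_trans dx); apply: qmax.
exists q; split=> //; apply/slopeP => //; apply/eqP.
by rewrite -subr_eq0; apply/eqP.
Qed.

End CompactSlope.

(** * Choice of the three points *)

Section Main.
Import numFieldNormedType.Exports.
Variables (R : realType) (n : nat) (X : 'I_n -> point R).

(** The bounds serve in turn to make the core nonempty, to give heavy sets at least [2 * k - 1]
    indices, and to make two of any three heavy sets share [k] indices. *)
Lemma exists_core_triple k m :
    (0 < k)%N -> (3 * k < n + 3)%N -> (2 * k + m < n + 3)%N ->
    (3 * (k + m) < 2 * n + 6)%N ->
  exists p1 p2 p3, [/\ core X k p1, core X k p2, core X k p3 &
    forall (a b c : R) (Q : {set 'I_n}), (n < m + #|Q|)%N ->
      in_halfplane a b c p1 -> in_halfplane a b c p2 -> in_halfplane a b c p3 ->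
      exists2 i, i \in Q & in_halfplane a b c (X i)].
Proof.
move=> k0 k3 k2m k3m; set D := core X k.
have cD : compact (D : set (R * R)) by apply: compact_core.
have [|||d [Dd _ _]] := @core_meet_hull2 R n X k [set: 'I_n] [set: 'I_n] k3.
- by rewrite cardsT card_ord; lia.
- by rewrite cardsT card_ord; lia.
- by rewrite setIid cardsT card_ord; lia.
have [|p [u [v [Dp dp]]]] := @exists_exposed R D _ cD; first by exists d.
(* Only hulls avoiding [p] have a trace of positive height, on which slopes make sense. *)
pose F (Q : {set 'I_n}) := (n < m + #|Q|)%N && ~~ `[< hull X Q p >].
have heavy a b c (Q : {set 'I_n}) : (n < m + #|Q|)%N -> in_halfplane a b c p ->
    (forall i, i \in Q -> ~~ in_halfplane a b c (X i)) -> F Q.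
  move=> hQ hp hi; rewrite /F hQ; apply/asboolPn => pQ.
  by have := hull_compl_halfplane hi pQ; rewrite hp.
pose K Q x := D x /\ hull X Q x.
have convK Q : convex_pred (K Q).
  move=> x y r t r0 t0 rt [Dx hx] [Dy hy].
  by split; [apply: convex_core|apply: convex_hull].
have dK Q x : F Q -> K Q x -> 0 < height p u v x.
  case/andP=> _ /asboolPn pQ [Dx hx]; apply: dp => // xp.
  by apply: pQ; rewrite -xp.
have /choice[e eK] : forall Q, exists e : point R * point R, F Q ->
    [/\ K Q e.1, K Q e.2 & forall z, K Q z ->
      slope p u v e.1 <= slope p u v z <= slope p u v e.2].
  move=> Q; have [FQ|] := boolP (F Q); last by exists (p, p).
  have [||x [y xy]] := @slope_extrema R (K Q) p u v _ _ (fun x => dK Q x FQ).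
  - have /andP[hQ _] := FQ.
    have [|||x [? ? _]] := @core_meet_hull2 R n X k Q Q k3;
      rewrite ?setIid; try lia.
    by exists x.
  - by apply: compact_closedI => //; apply: closed_hull.
  by exists (x, y).
(* When every heavy hull contains [p], the point [p] alone suffices. *)
have [[Q0 FQ0]|F0] := pselect (exists Q, F Q); last first.
  exists p, p, p; split=> // a b c Q hQ hp _ _.
  have [/exists_inP[i]|/exists_inPn hi] :=
    boolP [exists i in Q, in_halfplane a b c (X i)]; first by exists i.
  by case: F0; exists Q; apply: heavy hp hi.
have [||Q1 [Q2 [F1 F2 pierce]]] := @interval_pierce R _ F
    (fun Q => slope p u v (e Q).1) (fun Q => slope p u v (e Q).2)
    (ex_intro _ Q0 FQ0).
- by move=> Q FQ; have [h1 h2 /(_ _ h1)/andP[]] := eK Q FQ.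
(* Disjoint intervals mean hulls that do not meet in the core, hence fewer than [k] common
   indices. *)
- have sep (A B : {set 'I_n}) : F A -> F B ->
      slope p u v (e A).2 < slope p u v (e B).1 ->
      (#|A :&: B| < k)%N.
    move=> FA FB lt_AB; rewrite ltnNge; apply/negP => kAB.
    have [/andP[hA _] /andP[hB _]] := (FA, FB).
    have [|||x [Dx hxA hxB]] := @core_meet_hull2 R n X k A B k3; try lia.
    have [_ _ /(_ x (conj Dx hxA))/andP[_ xA]] := eK A FA.
    have [_ _ /(_ x (conj Dx hxB))/andP[xB _]] := eK B FB.
    by have := le_lt_trans xA (lt_le_trans lt_AB xB); rewrite ltxx.
  move=> A B C FA FB FC /sep => /(_ FA FB) hAB /sep => /(_ FA FC) hAC.
  move=> /sep => /(_ FB FC) hBC.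
  have := card_pair_meet A B C; rewrite card_ord.
  by move: FA FB FC => /andP[+ _] /andP[+ _] /andP[+ _]; lia.
have far Q : F Q -> exists q, [/\ D q, 0 < height p u v q,
    slope p u v q = slope p u v (e Q).2 &
    forall z, D z -> 0 < height p u v z ->
      slope p u v z = slope p u v (e Q).2 ->
      height p u v z <= height p u v q].
  move=> FQ; have [_ [De he] _] := eK Q FQ.
  exact: (exists_far_point cD De (dK _ _ FQ (conj De he)) erefl).
have [p2 [D2 d2 s2 max2]] := far Q1 F1.
have [p3 [D3 d3 s3 max3]] := far Q2 F2.
exists p, p2, p3; split=> // a b c Q hQ hp h2 h3.
have [/exists_inP[i]|/exists_inPn hi] :=
  boolP [exists i in Q, in_halfplane a b c (X i)]; first by exists i.
have FQ := heavy _ _ _ _ hQ hp hi.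
have [K1 K2 _] := eK Q FQ.
(* A point [z] of the trace in direction [t] lies between [p] and the farthest point [q], so in the
   halfplane, although the hull of [Q] is outside it. *)
have ray q (t : R) : in_halfplane a b c q -> slope p u v q = t ->
    (forall z, D z -> 0 < height p u v z -> slope p u v z = t ->
      height p u v z <= height p u v q) ->
    slope p u v (e Q).1 <= t <= slope p u v (e Q).2 -> False.
  move=> hq sq qmax tI.
  have [z Kz sz] := slope_between (convK Q) (fun z => dK Q z FQ) K1 K2 tI.
  have dz := dK Q z FQ Kz; have [Dz hz] := Kz.
  have := hull_compl_halfplane hi hz.
  have cH := @convex_halfplane R a b c.
  rewrite (convex_ray cH hp hq _ sz sq) //.
  by rewrite dz qmax.
case/orP: (pierce Q FQ) => tI.
- by case: (ray _ _ h2 s2 max2 tI).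
- by case: (ray _ _ h3 s3 max3 tI).
Qed.

End Main.

(** * From index sets to counts of points *)

Theorem theorem4 (R : realType) (n : nat) (P : seq (point R)) :
  uniq P -> size P = n -> general_position P ->
  exists p1 p2 p3 : point R,
    (forall a b c : R, is_halfplane a b c ->
       [|| in_halfplane a b c p1, in_halfplane a b c p2 | in_halfplane a b c p3] ->
       n%:R / 6 <= (count_in a b c P)%:R :> R) /\
    (forall a b c : R, is_halfplane a b c ->
       [&& in_halfplane a b c p1, in_halfplane a b c p2 & in_halfplane a b c p3] ->
       n%:R / 2 <= (count_in a b c P)%:R :> R).
Proof.
move=> _ sP _.
(* For [n = 0] the depth [k] would be 0, and [exists_core_triple] asks for [0 < k]. *)
have [n0|n_gt0] := posnP n.
  by exists (0, 0), (0, 0), (0, 0); split=> a b c _ _; rewrite n0 mul0r.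
pose X (i : 'I_n) : point R := nth (0, 0) P i.
pose out a b c := [set i | ~~ in_halfplane a b c (X i)].
have countE a b c : (count_in a b c P + #|out a b c| = n)%N.
  have -> : count_in a b c P = #|~: out a b c|.
    rewrite /count_in -sum1_count (big_nth (0, 0)) sP big_mkord -sum1_card.
    by apply: eq_bigl => i; rewrite !inE negbK.
  by rewrite addnC cardsC card_ord.
pose k := ((n + 5) %/ 6)%N; pose m := ((n + 1) %/ 2)%N.
have [||||p1 [p2 [p3 [D1 D2 D3 heavy]]]] := @exists_core_triple R n X k m;
  try by rewrite /k /m; lia.
have deep p a b c : core X k p -> in_halfplane a b c p ->
    n%:R / 6 <= (count_in a b c P)%:R :> R.
  move=> Dp hp; rewrite ler_pdivrMr // -natrM ler_nat leqNgt; apply/negP => lt.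
  have := countE a b c; have := Dp (out a b c) => hDp nE.
  (* A halfplane with too few points omits enough for [p] to lie in the hull of the omitted ones,
     which is outside the halfplane. *)
  have /hDp hull_p : (n < k + #|out a b c|)%N by rewrite /k; lia.
  suff : ~~ in_halfplane a b c p by rewrite hp.
  by apply: hull_compl_halfplane hull_p => i; rewrite inE.
exists p1, p2, p3; split=> a b c _.
  by case/or3P; apply: deep.
case/and3P=> h1 h2 h3; rewrite ler_pdivrMr // -natrM ler_nat leqNgt.
apply/negP => lt; have nE := countE a b c.
have heavy_out : (n < m + #|out a b c|)%N by rewrite /m; lia.
have [i] := heavy a b c (out a b c) heavy_out h1 h2 h3.
by rewrite inE => /negP.
Qed.
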